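(* There exist a two-dimensional normed linear space $X$ and functionals $f_1,f_2\in B(X^* )$ such that the following conditions are satisfied: 1) There exists precisely one point $x_1\in B(X)$ such that $f_1(x_1)=1$, and precisely one point $x_2\in B(X)$ such that $f_2(x_2)=1$. 2) The set $C=\{x\in X:\ |f_1(x)|\le 1,\ |f_2(x)|\le 1\}$ is a parallelogram and is a minimal sufficient enlargement for $X$. 3) There exists a linear functional $f_3\in B(X^* )$ such that $|f_3(x_1)|=|f_3(x_2)|=1$, where $x_1,x_2$ are the points from condition 1).
   Context: All spaces are real. $B(X)$ denotes the (closed) unit ball of a normed space $X$; $X^*$ is the dual space. A ball in a finite dimensional linear space means a bounded closed convex set with nonempty interior that is symmetric with respect to $0$. A ball $A$ in a finite dimensional normed space $X$ is called a sufficient enlargement for $X$ if for every Banach space $Y$ and every isometric linear embedding of $X$ into $Y$ (identify $X$ with its image) there exists a continuous linear projection $P:Y\to X$ onto $X$ such that $P(B(Y))\subset A$. A minimal sufficient enlargement is a sufficient enlargement no proper subset of which is a sufficient enlargement. *)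

(* Defs.v *)
From HB Require Import structures.
From mathcomp Require Import all_boot all_order all_algebra.
From mathcomp Require Import all_classical all_reals all_analysis.

Set Implicit Arguments.
Unset Strict Implicit.
Unset Printing Implicit Defensive.

Import Order.TTheory GRing.Theory Num.Theory.
Import numFieldNormedType.Exports.

Local Open Scope classical_set_scope.
Local Open Scope ring_scope.

Definition has_dim (K : fieldType) (n : nat) (V : lmodType K) : Prop :=
  exists h : {linear V -> 'rV[K]_n}, bijective h.

Definition unit_ball (R : realType) (X : normedModType R) : set X :=
  [set x | `|x| <= 1].
Arguments unit_ball {R} X.

(* Only meaningful for continuous [f]: [sup] is 0 on sets that are not bounded
   above. *)
Definition dual_norm (R : realType) (X : normedModType R)
    (f : {linear X -> R^o}) : R :=
  sup [set `|f x| | x in unit_ball X].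

Definition dual_unit_ball (R : realType) (X : normedModType R) :
    set {linear X -> R^o} :=
  [set f : {linear X -> R^o} | continuous f /\ dual_norm f <= 1].
Arguments dual_unit_ball {R} X.

Definition symmetric_ball (R : realType) (X : normedModType R) (A : set X) :
    Prop :=
  [/\ bounded_set A, closed A, convex_set A, A° !=set0
    & forall x, A x -> A (- x)].

(* [X] is identified with its image under the isometry [i]; [cancel i P] then
   says that [P] restricts to the identity on [X], i.e. that it is a projection
   onto [X]. *)
Definition sufficient_enlargement (R : realType) (X : normedModType R)
    (A : set X) : Prop :=
  symmetric_ball A /\
  forall (Y : completeNormedModType R) (i : {linear X -> Y}),
    (forall x, `|i x| = `|x|) ->
    exists P : {linear Y -> X},
      [/\ continuous P, cancel i P & P @` unit_ball Y `<=` A].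

Definition minimal_sufficient_enlargement (R : realType) (X : normedModType R)
    (A : set X) : Prop :=
  sufficient_enlargement A /\
  forall A' : set X, A' `<` A -> ~ sufficient_enlargement A'.

Definition parallelogram (R : realType) (X : lmodType R) (A : set X) : Prop :=
  exists p u v : X,
    (forall a b : R, a *: u + b *: v = 0 -> a = 0 /\ b = 0) /\
    A = [set p + s *: u + t *: v | s in `[0, 1] & t in `[0, 1]].

(* Main.v *)
Require Import Defs.
From HB Require Import structures.
From mathcomp Require Import all_boot all_order all_algebra.
From mathcomp Require Import all_classical all_reals all_analysis.
From mathcomp Require Import ring lra.
Import Order.TTheory GRing.Theory Num.Theory.
Import numFieldNormedType.Exports.
Local Open Scope classical_set_scope.
Local Open Scope ring_scope.

Set Implicit Arguments.
Unset Strict Implicit.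
Unset Printing Implicit Defensive.

(** Let [X] be the plane whose unit ball is the Euclidean disc cut by the strip
    [|x + y| <= 1], and let [f1], [f2], [f3] be [x], [y] and [x + y]. The ball
    touches the sides of the square [C] only at [(1, 0)] and [(0, 1)] (up to
    sign), and [f3] is [1] at both. Extending [f1] and [f2] by Hahn-Banach shows
    that [C] is a sufficient enlargement. For minimality, a single
    three-dimensional space [Y] containing [X] as [z = 0] is enough: its unit
    ball contains [(1, 1, 1)], [(1, -1, 1)] and, up to a factor
    [1 + O(t ^ 2)], the points [(1, -t, -t)]. A projection
    [(x + a z, y + b z)] that maps this ball into [C] satisfies [a = b = 0]
    because of these points, and then it maps [(1, 1, 1)] and [(1, -1, 1)] to
    corners of [C]. *)

(** * The Hahn-Banach theorem *)

Section HahnBanach.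
Variables (R : realType) (V : lmodType R).
Implicit Types (p q : V -> R) (G : V -> R -> Prop) (u v : V).

(** An inequality at every [t >= 0], zero included, passes directly to infima. For [t > 0] equality
    follows by scaling back with [t^-1]. *)
Definition sublinear p :=
  (forall u v, p (u + v) <= p u + p v) /\
  (forall t v, 0 <= t -> p (t *: v) <= t * p v).

Lemma sublinear_le0 p : sublinear p -> p 0 <= 0.
Proof. by move=> [_ /(_ 0 0 (lexx 0))]; rewrite scale0r mul0r. Qed.

(** From [0 <= q 0 <= q v + q (- v)]. The bound depends on [p] alone, so infima of families of such
    [q] are genuine. *)
Lemma sublinear_lower_bound p q v : sublinear q ->
  (forall u, q u <= p u) -> - p (- v) <= q v.
Proof.
move=> [qD qZ] qp; have := qD v (- v); rewrite subrr.
have := qD 0 0; rewrite addr0; have := qp (- v); lra.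
Qed.

Lemma le_inf_add (A B : set R) (c : R) : A !=set0 -> B !=set0 ->
  (forall a b, A a -> B b -> c <= a + b) -> c <= inf A + inf B.
Proof.
move=> A0 B0 cAB; rewrite -lerBlDr; apply: lb_le_inf => // a Aa.
rewrite lerBlDr addrC -lerBlDr; apply: lb_le_inf => // b Bb.
by rewrite lerBlDr addrC cAB.
Qed.

Lemma le_inf_scale (A : set R) (t c : R) : A !=set0 -> 0 <= t ->
  (t = 0 -> c <= 0) -> (forall a, A a -> c <= t * a) -> c <= t * inf A.
Proof.
move=> A0 t0 tc cA; have [t_eq0|tneq0] := eqVneq t 0.
  by rewrite t_eq0 mul0r tc.
have tgt0 : 0 < t by rewrite lt_def tneq0.
rewrite mulrC -ler_pdivrMr//; apply: lb_le_inf => // a Aa.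
by rewrite ler_pdivrMr// mulrC cA.
Qed.

(* The largest sublinear functional that lies below [p] and satisfies
   [q (- k) <= - a] for all [(k, a)] in the cone [G] of [V * R]. *)
Definition lower_along p G v : R :=
  inf [set r | exists k a, G k a /\ r = p (v + k) - a].

(** As a relation, [G] can be a ray as well as the graph of a functional on a subspace. The ray
    yields additivity of minimal functionals, the graph yields the extension. *)
Definition cone_below p G :=
  [/\ G 0 0, (forall k a l b, G k a -> G l b -> G (k + l) (a + b)),
      (forall t k a, 0 < t -> G k a -> G (t *: k) (t * a)) &
      forall k a, G k a -> a <= p k].

Section lower_along.
Variables (p : V -> R) (G : V -> R -> Prop).
Hypotheses (sp : sublinear p) (coneG : cone_below p G).

(** The set is bounded below by [- p (- v)], because [a <= p k <= p (v + k) + p (- v)]. *)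
Lemma lower_along_le v k a : G k a -> lower_along p G v <= p (v + k) - a.
Proof.
have [_ _ _ Gp] := coneG => Gka.
apply: ge_inf; last by exists k, a.
exists (- p (- v)) => _ [l [b [Glb ->]]].
have := Gp _ _ Glb; have := sp.1 (v + l) (- v).
rewrite addrAC subrr add0r; lra.
Qed.

Lemma sublinear_lower_along : sublinear (lower_along p G).
Proof.
have [G0 GD GZ _] := coneG.
have ne v : [set r | exists k a, G k a /\ r = p (v + k) - a] !=set0.
  by exists (p (v + 0) - 0); exists 0, 0.
split=> [u v|t v t0].
  apply: le_inf_add => // _ _ [k [a [Gka ->]]] [l [b [Glb ->]]].
  have := lower_along_le (u + v) (GD _ _ _ _ Gka Glb).
  rewrite addrACA; have := sp.1 (u + k) (v + l); lra.
apply: le_inf_scale => // [->|_ [k [a [Gka ->]]]].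
  rewrite scale0r (le_trans (lower_along_le 0 G0))// add0r subr0.
  exact: sublinear_le0.
have [->|tneq0] := eqVneq t 0.
  rewrite scale0r mul0r (le_trans (lower_along_le 0 G0))// add0r subr0.
  exact: sublinear_le0.
have tgt0 : 0 < t by rewrite lt_def tneq0.
have := lower_along_le (t *: v) (GZ _ _ _ tgt0 Gka).
have := sp.2 _ (v + k) t0; rewrite scalerDr mulrBr; lra.
Qed.

End lower_along.

Definition minimal_sublinear q :=
  sublinear q /\
  forall q', sublinear q' -> (forall v, q' v <= q v) -> forall v, q' v = q v.

(** Zorn's lemma on the sublinear functionals below [p]; a nonempty chain is bounded by its
    pointwise infimum. *)
Lemma exists_minimal_sublinear p : sublinear p ->
  exists2 q, minimal_sublinear q & forall v, q v <= p v.
Proof.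
move=> sp.
pose T := {q : V -> R | sublinear q /\ forall v, q v <= p v}.
(* The order is reversed, so that a maximal element is a minimal functional. *)
pose le (s t : T) := `[< forall v, sval t v <= sval s v >].
have [||||] := @Zorn T le.
- by move=> s; apply/asboolP.
- move=> r s t /asboolP rs /asboolP st; apply/asboolP => v.
  exact: le_trans (st v) (rs v).
- move=> [s ps] [t pt] /asboolP/= st /asboolP/= ts.
  have eqst : s = t by apply/funext => v; apply/eqP; rewrite eq_le ts st.
  by subst t; congr exist; exact: Prop_irrelevance.
(* The empty chain is bounded by [p] itself; an infimum over it would be the default value 0. *)
- move=> A totA; have [[s0 As0]|A0] := pselect (A !=set0); last first.
    exists (exist _ p (conj sp (fun v => lexx (p v)))) => s As.
    by case: A0; exists s.
  pose Av v := [set sval s v | s in A].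
  have ne v : Av v !=set0 by exists (sval s0 v); exists s0.
  have leA s v : A s -> inf (Av v) <= sval s v.
    move=> As; apply: ge_inf; last by exists s.
    exists (- p (- v)) => _ [t _ <-]; case: (svalP t) => st tp.
    exact: sublinear_lower_bound.
  suff sq : sublinear (fun v => inf (Av v)) /\ forall v, inf (Av v) <= p v.
    exists (exist _ (fun v => inf (Av v)) sq) => s As; apply/asboolP => v.
    exact: leA.
  split; last by move=> v; exact: le_trans (leA _ v As0) ((svalP s0).2 v).
  split=> [u v|t v t0].
    apply: le_inf_add => // _ _ [s As <-] [t At <-].
    (* The smaller of [s] and [t] serves at both [u] and [v], so its own subadditivity suffices. *)
    have [/asboolP st|/asboolP ts] := totA _ _ As At.
      apply: le_trans (leA t _ At) _; apply: le_trans ((svalP t).1.1 u v) _.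
      by rewrite lerD2r.
    apply: le_trans (leA s _ As) _; apply: le_trans ((svalP s).1.1 u v) _.
    by rewrite lerD2l.
  apply: le_inf_scale => // [->|_ [s As <-]].
    rewrite scale0r (le_trans (leA _ _ As0))//.
    exact: sublinear_le0 (svalP s0).1.
  by apply: le_trans (leA s _ As) _; exact: (svalP s).1.2.
move=> [q [sq qp]] qmax; exists q => //; split=> // q' sq' q'q v.
have q'p u : q' u <= p u by exact: le_trans (q'q u) (qp u).
pose s' : T := exist _ q' (conj sq' q'p).
suff /qmax/(congr1 sval)/= -> : le (exist _ q (conj sq qp)) s' by [].
exact/asboolP.
Qed.

(* Lowering [q] along the ray through [v] changes nothing, which turns
   subadditivity into additivity. *)
Lemma minimal_sublinearD q : minimal_sublinear q ->
  forall u v, q (u + v) = q u + q v.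
Proof.
move=> [sq qmin] u v; apply/eqP; rewrite eq_le sq.1/=.
pose G (k : V) (a : R) := exists2 t, 0 <= t & k = t *: v /\ a = t * q v.
have coneG : cone_below q G.
  split=> [|_ _ _ _ [t t0 [-> ->]] [s s0 [-> ->]]|t _ _ t0 [s s0 [-> ->]]|].
  - by exists 0; rewrite // scale0r mul0r.
  - by exists (t + s); rewrite ?addr_ge0// scalerDl mulrDl.
  - by exists (t * s); rewrite ?mulr_ge0 ?(ltW t0)// scalerA mulrA.
  - move=> _ _ [t t0 [-> ->]]; have [->|tneq0] := eqVneq t 0.
      have := sq.1 0 0; rewrite scale0r addr0 mul0r; lra.
    have tV : 0 <= t^-1 by rewrite invr_ge0.
    have := sq.2 _ (t *: v) tV; rewrite scalerA mulVf// scale1r => H.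
    by rewrite mulrC -ler_pdivlMr ?lt_def ?tneq0// mulrC.
have lowE w : lower_along q G w = q w.
  apply: qmin; first exact: sublinear_lower_along.
  move=> w'; have [G0 _ _ _] := coneG.
  by have := lower_along_le sq coneG w' G0; rewrite addr0 subr0.
rewrite -lerBrDr -[leLHS]lowE.
by apply: lower_along_le => //; exists 1; rewrite // scale1r mul1r.
Qed.

(** Additivity makes [q] odd. The homogeneity inequality at [v] and [- v] then becomes an equality,
    and oddness covers negative scalars. *)
Lemma minimal_sublinear_linear q : minimal_sublinear q ->
  exists F : {linear V -> R^o}, forall v, F v = q v.
Proof.
move=> mq; have qD := minimal_sublinearD mq; have [[_ qle] _] := mq.
have q0 : q 0 = 0 by have := qD 0 0; rewrite addr0; lra.
have qN v : q (- v) = - q v by have := qD v (- v); rewrite subrr q0; lra.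
have qZ0 t v : 0 <= t -> q (t *: v) = t * q v.
  move=> t0; apply/eqP; rewrite eq_le qle//=.
  by have := qle _ (- v) t0; rewrite scalerN !qN; lra.
have qZ t v : q (t *: v) = t * q v.
  have [/qZ0//|t0] := leP 0 t.
  by rewrite -[t]opprK scaleNr qN qZ0 ?oppr_ge0 ?(ltW t0)// !mulNr.
have lq : linear (q : V -> R^o) by move=> t u v; rewrite qD qZ.
pose M := GRing.isLinear.Build R V R^o *:%R (q : V -> R^o) lq.
pose F : {linear V -> R^o} := HB.pack (q : V -> R^o) M.
by exists F.
Qed.

(** A linear functional below [p] lowered along the graph of [f] is at most [f] on the image of [i];
    applying this to [x] and [- x] gives equality. *)
Theorem hahn_banach (U : lmodType R) (i : {linear U -> V})
    (f : {linear U -> R^o}) p :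
  sublinear p -> (forall x, f x <= p (i x)) ->
  exists F : {linear V -> R^o},
    (forall v, F v <= p v) /\ forall x, F (i x) = f x.
Proof.
move=> sp fp.
pose G (k : V) (a : R) := exists x, k = i x /\ a = f x.
have coneG : cone_below p G.
  split=> [|_ _ _ _ [x [-> ->]] [y [-> ->]]|t _ _ t0 [x [-> ->]]|].
  - by exists 0; rewrite !linear0.
  - by exists (x + y); rewrite !linearD.
  - by exists (t *: x); rewrite !linearZ.
  - by move=> _ _ [x [-> ->]].
have [q mq qle] := exists_minimal_sublinear (sublinear_lower_along sp coneG).
have [F Fq] := minimal_sublinear_linear mq.
have Fi x : F (i x) <= f x.
  rewrite Fq; apply: le_trans (qle _) _.
  have Gx : G (i (- x)) (f (- x)) by exists (- x).
  have := lower_along_le sp coneG (i x) Gx.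
  rewrite -linearD subrr [f (- x)]linearN linear0 opprK => /le_trans; apply.
  by rewrite gerDr sublinear_le0.
exists F; split=> [v|x].
  rewrite Fq; apply: le_trans (qle _) _; have [G0 _ _ _] := coneG.
  by have := lower_along_le sp coneG v G0; rewrite addr0 subr0.
apply/eqP; rewrite eq_le Fi/=.
by have := Fi (- x); rewrite !linearN lerN2.
Qed.

End HahnBanach.

(** * Norms on row vectors *)

(* [rV_norm_coord] amounts to definiteness by compactness; this form gives
   completeness without a compactness argument. *)
Record rV_norm (R : realType) (n : nat) := RVNorm {
  rV_norm_fun :> 'rV[R]_n -> R;
  rV_normD : forall u v, rV_norm_fun (u + v) <= rV_norm_fun u + rV_norm_fun v;
  rV_normZ : forall t v, rV_norm_fun (t *: v) = `|t| * rV_norm_fun v;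
  rV_norm_coord : exists2 K : R, 0 < K &
    forall (v : 'rV[R]_n) i, `|v ord0 i| <= K * rV_norm_fun v }.

(** A separate name for the row vectors, so that [N] does not clash with the sup norm they already
    carry. *)
Definition rV_normed (R : realType) (n : nat) (N : rV_norm R n) : Type :=
  'rV[R]_n.

Section rV_normed.
Variables (R : realType) (n : nat) (N : rV_norm R n).

HB.instance Definition _ := GRing.Lmodule.on (rV_normed N).

Lemma rV_norm_eq0 (v : rV_normed N) : N v = 0 -> v = 0.
Proof.
move=> Nv0; have [K _ NK] := rV_norm_coord N.
apply/rowP => i; rewrite [RHS]mxE; apply/eqP; rewrite -normr_le0.
by rewrite (le_trans (NK v i))// Nv0 mulr0.
Qed.

HB.instance Definition _ := Lmodule_isNormed.Build R (rV_normed N)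
  (@rV_normD R n N) (@rV_normZ R n N) rV_norm_eq0.

Lemma rV_normedE (v : rV_normed N) : `|v| = N v.
Proof. by []. Qed.

Lemma rV_norm_le : exists2 K : R, 0 < K & forall v : 'rV[R]_n, N v <= K * `|v|.
Proof.
have N0 v : 0 <= N v by rewrite -rV_normedE.
(* The triangle inequality on the standard basis gives the sum; the added 1 makes the constant
   positive even for [n = 0]. *)
exists (1 + \sum_i N (delta_mx ord0 i)).
  by rewrite ltr_pwDl// sumr_ge0.
move=> v; rewrite {1}(row_sum_delta v) mulrDl mul1r.
apply: (@le_trans _ _ (\sum_i `|v ord0 i| * N (delta_mx ord0 i))).
  elim/big_ind2 : _ => [|x1 x2 y1 y2 le1 le2|i _].
  - by rewrite -(scale0r 0) rV_normZ normr0 mul0r.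
  - by rewrite (le_trans (rV_normD _ _ _))// lerD.
  - by rewrite rV_normZ.
rewrite ler_wpDl// mulr_suml ler_sum// => i _.
rewrite mulrC ler_wpM2l//.
rewrite [leRHS]/Num.norm /= mx_normrE; apply/bigmax_geP; right => /=.
by exists (ord0, i).
Qed.

(** [N] and the sup norm bound each other up to constants, so Cauchy filters and their limits carry
    over. *)
Lemma rV_normed_complete (F : set_system (rV_normed N)) :
  ProperFilter F -> cauchy F -> cvg F.
Proof.
move=> FF /cauchy_ballP Fc.
have [K K0 NK] := rV_norm_coord N; have [K' K'0 NK'] := rV_norm_le.
have Fc' : cauchy (F : set_system 'rV[R]_n).
  apply/cauchy_ballP => e e0.
  have eK : 0 < e / K by rewrite divr_gt0.
  apply: filterS (Fc _ eK) => -[u v] /=.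
  rewrite -!ball_normE/= rV_normedE => uv.
  rewrite [ltLHS]/Num.norm /= mx_normrE; apply/bigmax_ltP.
  split => // -[i j] _ /=.
  rewrite ord1 (le_lt_trans (NK _ _))//.
  by rewrite mulrC -ltr_pdivlMr.
have /cvg_ex[l Fl] := @cauchy_cvg 'rV[R]_n F FF Fc'.
apply/cvg_ex; exists (l : rV_normed N).
apply/cvg_ballP => e e0.
have eK : 0 < e / K' by rewrite divr_gt0.
move/cvg_ballP : Fl => /(_ _ eK).
apply: filterS => u; rewrite -!ball_normE/= rV_normedE => lu.
by rewrite (le_lt_trans (NK' _))// mulrC -ltr_pdivlMr.
Qed.

HB.instance Definition _ :=
  Uniform_isComplete.Build (rV_normed N) rV_normed_complete.

End rV_normed.

(** * The norms of [X] and [Y] *)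

Section hypot.
Variable R : rcfType.
Implicit Types a b c t x y z : R.

Definition hypot a b := Num.sqrt (a ^+ 2 + b ^+ 2).

Lemma hypot_sqr a b : hypot a b ^+ 2 = a ^+ 2 + b ^+ 2.
Proof. by rewrite sqr_sqrtr// addr_ge0// sqr_ge0. Qed.

Lemma hypot_ge0 a b : 0 <= hypot a b.
Proof. exact: sqrtr_ge0. Qed.

Lemma hypot_le a b c : 0 <= c -> a ^+ 2 + b ^+ 2 <= c ^+ 2 -> hypot a b <= c.
Proof. by move=> c0; rewrite -hypot_sqr ler_pXn2r// nnegrE hypot_ge0. Qed.

(** Squaring reduces this to Cauchy-Schwarz, which follows from Lagrange's identity with the square
    of [a * b' - b * a']. *)
Lemma ler_hypotD a b a' b' : hypot (a + a') (b + b') <= hypot a b + hypot a' b'.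
Proof.
apply: hypot_le; first by rewrite addr_ge0// hypot_ge0.
suff : a * a' + b * b' <= hypot a b * hypot a' b'.
  rewrite !sqrrD !hypot_sqr; lra.
apply: le_trans (ler_norm _) _.
rewrite -(@ler_pXn2r _ 2)// ?nnegrE ?mulr_ge0 ?hypot_ge0//.
rewrite real_normK ?num_real// exprMn !hypot_sqr.
have := sqr_ge0 (a * b' - b * a'); nra.
Qed.

Lemma ler_hypot a b a' b' : 0 <= a -> 0 <= b -> a <= a' -> b <= b' ->
  hypot a b <= hypot a' b'.
Proof.
move=> a0 b0 aa' bb'; apply: hypot_le; first exact: hypot_ge0.
by rewrite hypot_sqr lerD// ler_pXn2r// nnegrE// (le_trans _ aa', le_trans _ bb').
Qed.

Lemma hypotZ t a b : 0 <= t -> hypot (t * a) (t * b) = t * hypot a b.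
Proof.
move=> t0; rewrite /hypot !exprMn -mulrDr sqrtrM ?sqr_ge0//.
by rewrite sqrtr_sqr ger0_norm.
Qed.

(* On [z = 0] this is the Euclidean norm in the quadrant [x >= 0 >= y]. The way
   it depends on [z] keeps it at most 1 at [(1, 1, 1)], [(1, -1, 1)] and their
   opposites. *)
Definition arc_gauge x y z :=
  z + hypot (Num.max (x - z) 0) (Num.max (- (y + z)) 0).

Lemma ler_arc_gaugeD x y z x' y' z' :
  arc_gauge (x + x') (y + y') (z + z') <=
  arc_gauge x y z + arc_gauge x' y' z'.
Proof.
rewrite /arc_gauge [leRHS]addrACA lerD2l.
apply: le_trans (ler_hypotD _ _ _ _).
have maxD a b : Num.max (a + b) 0 <= Num.max a 0 + Num.max b 0.
  by rewrite ge_max lerD ?addr_ge0 ?le_max ?lexx ?orbT.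
by apply: ler_hypot; rewrite ?le_max ?lexx ?orbT//;
  apply: le_trans (maxD _ _); rewrite le_eqVlt; apply/orP; left; apply/eqP;
  congr Num.max; ring.
Qed.

Lemma arc_gaugeZ t x y z : 0 <= t ->
  arc_gauge (t * x) (t * y) (t * z) = t * arc_gauge x y z.
Proof.
move=> t0; rewrite /arc_gauge mulrDr -hypotZ// !maxr_pMr// !mulr0.
by congr (_ + hypot (Num.max _ _) (Num.max _ _)); ring.
Qed.

(** On [z = 0] this is [|x + y|] where [x] and [y] have the same sign and the Euclidean norm
    elsewhere: the gauge of the cut disc. *)
Definition cut_disc_norm x y z :=
  Num.max `|x + y - z| (Num.max (arc_gauge x y z) (arc_gauge (- x) (- y) (- z))).

Lemma ler_cut_disc_normD x y z x' y' z' :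
  cut_disc_norm (x + x') (y + y') (z + z') <=
  cut_disc_norm x y z + cut_disc_norm x' y' z'.
Proof.
rewrite /cut_disc_norm ge_max; apply/andP; split.
  rewrite (_ : _ - _ = (x + y - z) + (x' + y' - z')); last by ring.
  by rewrite (le_trans (ler_normD _ _))// lerD// le_max lexx.
rewrite ge_max !opprD; apply/andP; split.
  by apply: le_trans (ler_arc_gaugeD _ _ _ _ _ _) _;
    rewrite lerD// !le_max lexx ?orbT.
by apply: le_trans (ler_arc_gaugeD _ _ _ _ _ _) _;
    rewrite lerD// !le_max lexx ?orbT.
Qed.

Lemma cut_disc_normN x y z :
  cut_disc_norm (- x) (- y) (- z) = cut_disc_norm x y z.
Proof.
rewrite /cut_disc_norm -!opprD normrN !opprK.
by congr Num.max; rewrite maxC.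
Qed.

Lemma cut_disc_normZ t x y z :
  cut_disc_norm (t * x) (t * y) (t * z) = `|t| * cut_disc_norm x y z.
Proof.
wlog t0 : t x y z / 0 <= t => [IH|].
  have [/IH//|t0] := leP 0 t.
  have := IH (- t) (- x) (- y) (- z).
  rewrite oppr_ge0 !mulrNN => /(_ (ltW t0)) ->.
  by rewrite normrN cut_disc_normN.
rewrite /cut_disc_norm -!mulrN !arc_gaugeZ// -mulrDr -mulrDr normrM.
by rewrite (ger0_norm t0) !maxr_pMr.
Qed.

Lemma cut_disc_norm_le1 x y z :
  cut_disc_norm x y z <= 1 <->
  [/\ `|x + y - z| <= 1, arc_gauge x y z <= 1 &
      arc_gauge (- x) (- y) (- z) <= 1].
Proof.
by rewrite /cut_disc_norm !ge_max; split=> [/and3P[]//|[-> -> ->]].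
Qed.

(** The hypotenuse dominates [x - z] and [- (y + z)], and the summand [z] cancels the shift. *)
Lemma ler_arc_gauge x y z :
  x <= arc_gauge x y z /\ - y <= arc_gauge x y z.
Proof.
rewrite /arc_gauge; have := hypot_sqr (Num.max (x - z) 0) (Num.max (- (y + z)) 0).
have := hypot_ge0 (Num.max (x - z) 0) (Num.max (- (y + z)) 0).
move: (hypot _ _) => h h0 hE.
have le_h a b : a ^+ 2 <= h ^+ 2 -> b <= a -> b <= h.
  move=> ah ba; apply: le_trans ba _; apply: le_trans (ler_norm _) _.
  by rewrite -(@ler_pXn2r _ 2)// ?nnegrE// real_normK// num_real.
have := le_h (Num.max (x - z) 0) (x - z).
rewrite hE lerDl sqr_ge0 le_max lexx => /(_ isT isT).
have := le_h (Num.max (- (y + z)) 0) (- (y + z)).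
rewrite hE lerDr sqr_ge0 le_max lexx => /(_ isT isT); lra.
Qed.

(** The factor 3 comes from writing [z] as [x + y] minus [x + y - z]. On [z = 0] the other bounds
    put the three functionals in the dual ball. *)
Lemma cut_disc_norm_coord x y z :
  [/\ `|x| <= cut_disc_norm x y z, `|y| <= cut_disc_norm x y z,
      `|z| <= 3 * cut_disc_norm x y z & `|x + y - z| <= cut_disc_norm x y z].
Proof.
set s := cut_disc_norm x y z.
have [sxyz sg sg'] : [/\ `|x + y - z| <= s, arc_gauge x y z <= s &
    arc_gauge (- x) (- y) (- z) <= s].
  by rewrite /s /cut_disc_norm !le_max !lexx !orbT.
have [? ?] := ler_arc_gauge x y z; have [? ?] := ler_arc_gauge (- x) (- y) (- z).
have xs : `|x| <= s by rewrite ler_norml; lra.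
have ys : `|y| <= s by rewrite ler_norml; lra.
split=> //; move: sxyz xs ys; rewrite !ler_norml; lra.
Qed.

Lemma cut_disc_norm_corners :
  cut_disc_norm 1 1 1 <= 1 /\ cut_disc_norm 1 (-1) 1 <= 1.
Proof.
have hyp0 : hypot 0 0 = 0 by rewrite /hypot expr0n addr0 sqrtr0.
split; apply/cut_disc_norm_le1; rewrite /arc_gauge.
  rewrite !subrr [Num.max (- (1 + 1)) 0]max_r; last by lra.
  rewrite [Num.max (- (_ - _)) 0]max_l; last by lra.
  rewrite maxxx hyp0 addr0 addrK normr1; split=> //.
  by rewrite addrC lerBlDr; apply: hypot_le; lra.
rewrite !subrr !opprK !(subrr, addNr).
rewrite add0r oppr0 maxxx hyp0 normrN normr1 !addr0.
by split; lra.
Qed.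

(** The excess over 1 is only quadratic, because [(1 + t)^2 + (2 t)^2 <= (1 + t + 2 t^2)^2]. *)
Lemma cut_disc_norm_curve t : 0 <= t <= 1 ->
  cut_disc_norm 1 (- t) (- t) <= 1 + 2 * t ^+ 2.
Proof.
move=> /andP[t0 t1]; have t2 := sqr_ge0 t.
rewrite /cut_disc_norm !ge_max /arc_gauge; apply/and3P; split.
- by rewrite (_ : _ - _ = 1) ?normr1; [lra|ring].
- rewrite !max_l; try lra.
  rewrite addrC lerBlDr; apply: hypot_le; first lra.
  nra.
- rewrite !max_r; try lra.
  rewrite /hypot expr0n addr0 sqrtr0; nra.
Qed.

(** The strip forces [y <= 0]; there the norm is Euclidean, and [1 + y^2 <= 1] leaves only 0. *)
Lemma cut_disc_norm_1l_le1 y : cut_disc_norm 1 y 0 <= 1 <-> y = 0.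
Proof.
rewrite cut_disc_norm_le1; split=> [[]|->].
  rewrite /arc_gauge !subr0 add0r addr0 => + H _.
  rewrite ler_norml => /andP[_ y0]; have {}y0 : y <= 0 by lra.
  have := hypot_sqr (Num.max 1 0) (Num.max (- y) 0).
  have := hypot_ge0 (Num.max 1 0) (Num.max (- y) 0).
  rewrite !max_l; try lra.
  rewrite /arc_gauge !max_l in H; try lra.
  move: H; move: (hypot _ _) => h ? ? ?; nra.
rewrite /arc_gauge oppr0 !(subr0, addr0, add0r) oppr0.
rewrite [Num.max 1 0]max_l// [Num.max (-1) 0]max_r; last by lra.
rewrite maxxx normr1; split=> //; apply: hypot_le; lra.
Qed.

(** On [z = 0], swapping the coordinates exchanges the two arc gauges. *)
Lemma cut_disc_norm_1r_le1 x : cut_disc_norm x 1 0 <= 1 <-> x = 0.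
Proof.
suff -> : cut_disc_norm x 1 0 = cut_disc_norm 1 x 0.
  exact: cut_disc_norm_1l_le1.
rewrite /cut_disc_norm (addrC x) /arc_gauge !(oppr0, subr0, addr0, add0r).
rewrite !opprK; congr Num.max; rewrite maxC; congr Num.max.
  by rewrite /hypot addrC.
by rewrite /hypot addrC.
Qed.
End hypot.

(** * Functionals of norm at most one, and convexity *)

Lemma contraction_continuous (R : realType) (V : normedModType R)
  (f : {linear V -> R^o}) : (forall v, f v <= `|v|) -> continuous f.
Proof.
move=> f1; apply/bounded_linear_continuous/bounded_funP => r.
exists r => v vr; rewrite ler_norml -[- r <= _]lerN2 opprK -(linearN f).
by rewrite !(le_trans (f1 _))// normrN.
Qed.

(** A one-sided bound suffices, since it also holds at [- v]. *)
Lemma dual_unit_ballP (R : realType) (V : normedModType R)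
  (f : {linear V -> R^o}) : (forall v, f v <= `|v|) -> dual_unit_ball V f.
Proof.
move=> f1; split; first exact: contraction_continuous.
apply: ge_sup; first by exists `|f 0|, 0; rewrite //= /unit_ball/= normr0.
move=> _ [v v1 <-]; rewrite ler_norml -[- 1 <= _]lerN2 opprK -(linearN f).
by rewrite !(le_trans (f1 _))// normrN.
Qed.

Lemma norm_unit_ball_le (R : realType) (V : normedModType R)
  (f : {linear V -> R^o}) :
  (forall v, unit_ball V v -> f v <= 1) -> forall v, f v <= `|v|.
Proof.
move=> f1 v; have [->|v0] := eqVneq v 0; first by rewrite linear0 normr0.
have nv0 : 0 < `|v| by rewrite normr_gt0.
have : f (`|v|^-1 *: v) <= 1.
  apply: f1; rewrite /unit_ball/= normrZ ger0_norm ?invr_ge0//.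
  by rewrite mulVf// gt_eqF.
by rewrite linearZ/= /GRing.scale/= mulrC ler_pdivrMr// mul1r.
Qed.

Lemma convex_set_line (R : realType) (V : lmodType R) (A : set V) (u v : V) t :
  convex_set A -> A u -> A v -> 0 <= t <= 1 -> A (t *: u + (1 - t) *: v).
Proof.
move=> cA Au Av /andP[t0 t1].
have := cA u v (Itv01 t0 t1); rewrite !inE => /(_ Au Av).
by [].
Qed.

(** * The plane, the space and the embedding *)

Section Example.
Variable R : realType.

Definition cut_disc2 (v : 'rV[R]_2) : R := cut_disc_norm (v 0 0) (v 0 1) 0.
Definition cut_disc3 (v : 'rV[R]_3) : R :=
  cut_disc_norm (v 0 0) (v 0 1) (v 0 2).

Lemma cut_disc2D u v : cut_disc2 (u + v) <= cut_disc2 u + cut_disc2 v.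
Proof.
rewrite /cut_disc2 !mxE.
by have := ler_cut_disc_normD (u 0 0) (u 0 1) 0 (v 0 0) (v 0 1) 0; rewrite addr0.
Qed.

Lemma cut_disc2Z t v : cut_disc2 (t *: v) = `|t| * cut_disc2 v.
Proof. by rewrite /cut_disc2 !mxE -cut_disc_normZ mulr0. Qed.

Lemma cut_disc2_coord : exists2 K : R, 0 < K &
  forall (v : 'rV[R]_2) i, `|v ord0 i| <= K * cut_disc2 v.
Proof.
exists 1 => // v i; have [? ? _ _] := cut_disc_norm_coord (v 0 0) (v 0 1) 0.
rewrite mul1r; case: i => -[|[|//]] lti.
- by rewrite (_ : Ordinal lti = 0)//; apply: val_inj.
- by rewrite (_ : Ordinal lti = 1)//; apply: val_inj.
Qed.

Lemma cut_disc3D u v : cut_disc3 (u + v) <= cut_disc3 u + cut_disc3 v.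
Proof. by rewrite /cut_disc3 !mxE ler_cut_disc_normD. Qed.

Lemma cut_disc3Z t v : cut_disc3 (t *: v) = `|t| * cut_disc3 v.
Proof. by rewrite /cut_disc3 !mxE -cut_disc_normZ. Qed.

Lemma cut_disc3_coord : exists2 K : R, 0 < K &
  forall (v : 'rV[R]_3) i, `|v ord0 i| <= K * cut_disc3 v.
Proof.
exists 3 => // v i.
have [v0 v1 v2 _] := cut_disc_norm_coord (v 0 0) (v 0 1) (v 0 2).
rewrite /cut_disc3; case: i => -[|[|[|//]]] lti.
- rewrite (_ : Ordinal lti = 0); last exact: val_inj.
  by have := normr_ge0 (v 0 0); lra.
- rewrite (_ : Ordinal lti = 1); last exact: val_inj.
  by have := normr_ge0 (v 0 1); lra.
- by rewrite (_ : Ordinal lti = 2); last exact: val_inj.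
Qed.

Definition plane : completeNormedModType R :=
  rV_normed (RVNorm cut_disc2D cut_disc2Z cut_disc2_coord).
Definition space : completeNormedModType R :=
  rV_normed (RVNorm cut_disc3D cut_disc3Z cut_disc3_coord).
Local Notation X := plane.
Local Notation Y := space.

Definition point2 (x y : R) : X := \row_(j < 2) [:: x; y]`_j.
Definition point3 (x y z : R) : Y := \row_(j < 3) [:: x; y; z]`_j.
Definition coord2 (j : 'I_2) (v : X) : R^o := (v : 'rV[R]_2) 0 j.

Lemma coord2_linear j : linear (coord2 j).
Proof. by move=> t u v; rewrite /coord2 !mxE. Qed.
HB.instance Definition _ j :=
  GRing.isLinear.Build R X R^o *:%R (coord2 j) (coord2_linear j).

Definition embed (v : X) : Y := point3 (coord2 0 v) (coord2 1 v) 0.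
Lemma embed_linear : linear embed.
Proof.
move=> t u v; apply/rowP => -[[|[|[|//]]] lti]; rewrite !mxE//=.
- exact: coord2_linear.
- exact: coord2_linear.
- by rewrite mulr0 addr0.
Qed.
HB.instance Definition _ := GRing.isLinear.Build R X Y *:%R embed embed_linear.

Lemma embed_isometry v : `|embed v| = `|v|.
Proof. by rewrite !rV_normedE /= /cut_disc3 /cut_disc2 !mxE. Qed.

Lemma point2_coord (v : X) : point2 (coord2 0 v) (coord2 1 v) = v.
Proof.
apply/rowP => -[[|[|//]] lti]; rewrite !mxE/=; congr (v _ _); exact: val_inj.
Qed.

Lemma coord2_point0 x y : coord2 0 (point2 x y) = x.
Proof. by rewrite /coord2 mxE. Qed.

Lemma coord2_point1 x y : coord2 1 (point2 x y) = y.
Proof. by rewrite /coord2 mxE. Qed.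

Lemma norm_point2 x y : `|point2 x y| = cut_disc_norm x y 0.
Proof. by rewrite rV_normedE /= /cut_disc2 !mxE. Qed.

Lemma norm_point3 x y z : `|point3 x y z| = cut_disc_norm x y z.
Proof. by rewrite rV_normedE /= /cut_disc3 !mxE. Qed.

Lemma scale_point2 t x y : t *: point2 x y = point2 (t * x) (t * y).
Proof. by apply/rowP => -[[|[|//]] lti]; rewrite !mxE. Qed.

Lemma add_point2 x y x' y' : point2 x y + point2 x' y' = point2 (x + x') (y + y').
Proof. by apply/rowP => -[[|[|//]] lti]; rewrite !mxE. Qed.

(** Hence a projection onto the embedded plane is determined by its value at [point3 0 0 1]. *)
Lemma point3E x y z : point3 x y z = embed (point2 x y) + z *: point3 0 0 1.
Proof.
by apply/rowP => -[[|[|[|//]]] lti]; rewrite !mxE/= ?coord2_point0 ?coord2_point1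
  ?mulr0 ?mulr1 ?addr0 ?add0r.
Qed.

Lemma coord2_le_norm j (v : X) : coord2 j v <= `|v|.
Proof.
apply: le_trans (ler_norm _) _.
rewrite -{2}(point2_coord v) norm_point2.
have [? ? _ _] := cut_disc_norm_coord (coord2 0 v) (coord2 1 v) 0.
case: j => -[|[|//]] lti.
- by rewrite (_ : Ordinal lti = 0)//; apply: val_inj.
- by rewrite (_ : Ordinal lti = 1)//; apply: val_inj.
Qed.

(** * The square as a sufficient enlargement *)

Definition square : set X :=
  [set v | `|coord2 0 v| <= 1 /\ `|coord2 1 v| <= 1].

Lemma symmetric_ball_square : symmetric_ball square.
Proof.
have coord_cont j : continuous (coord2 j).
  by apply: (@contraction_continuous R X (coord2 j)) => v; exact: coord2_le_norm.
split.
- exists (`|point2 1 0| + `|point2 0 1|); split; first exact: num_real.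
  move=> r ltr v [v0 v1]; apply: le_trans (ltW ltr) => /=.
  rewrite -(point2_coord v) (_ : point2 _ _ =
    coord2 0 v *: point2 1 0 + coord2 1 v *: point2 0 1); last first.
    by rewrite !scale_point2 add_point2 !mulr1 !mulr0 addr0 add0r.
  by rewrite (le_trans (ler_normD _ _))// lerD// normrZ ler_piMl.
- have cl j : closed [set v | `|coord2 j v| <= 1].
    apply: (@closed_comp _ _ (fun v : X => `|coord2 j v|) [set r : R | r <= 1]).
      move=> v _; apply: continuous_comp; first exact: coord_cont.
      exact: norm_continuous.
    exact: closed_le.
  exact: (closedI (cl 0) (cl 1)).
- move=> u v t; rewrite !inE => -[u0 u1] [v0 v1].
  have le1 a b : `|a| <= 1 -> `|b| <= 1 ->
      `|t%:num * a + (1 - t%:num) * b| <= 1 :> R.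
    have t0 : 0 <= t%:num by [].
    have t1 : t%:num <= 1 by [].
    rewrite !ler_norml; nra.
  by split; rewrite linearD !linearZ; exact: le1.
(* Coordinates are bounded by the norm, so the open unit ball lies in the square. *)
- exists 0; apply/nbhs_ballP; exists 1 => //= v.
  rewrite -ball_normE/= sub0r normrN => v1.
  by split; rewrite ler_norml -[- 1 <= _]lerN2 opprK -linearN;
    rewrite !(le_trans (coord2_le_norm _ _))// ?normrN ltW.
- by move=> v [v0 v1]; split; rewrite linearN normrN.
Qed.

Lemma sufficient_square : sufficient_enlargement square.
Proof.
split; first exact: symmetric_ball_square.
move=> Z i iso.
have subnorm : sublinear (fun z : Z => `|z|).
  split=> [u v|t v t0]; first exact: ler_normD.
  by rewrite normrZ ger0_norm.
have ext j : exists F : {linear Z -> R^o},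
    (forall z, F z <= `|z|) /\ forall v, F (i v) = coord2 j v.
  by apply: hahn_banach => // v; rewrite iso coord2_le_norm.
have [F0 [F0le F0i]] := ext 0; have [F1 [F1le F1i]] := ext 1.
(* The two extensions are the coordinates of the projection. *)
pose Q (z : Z) : X := point2 (F0 z) (F1 z).
have Qlin : linear Q.
  move=> t u v; rewrite /Q scale_point2 add_point2.
  by rewrite !linearD !linearZ.
pose M := GRing.isLinear.Build R Z X *:%R Q Qlin.
pose P : {linear Z -> X} := HB.pack Q M.
have F01 (F : {linear Z -> R^o}) :
    (forall z, F z <= `|z|) -> forall z, `|F z| <= `|z|.
  move=> Fle z; rewrite ler_norml Fle andbT -[- _ <= _]lerN2 opprK -(linearN F).
  by rewrite (le_trans (Fle _))// normrN.
exists P; split.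
- apply/bounded_linear_continuous/bounded_funP => r.
  exists (r * `|point2 1 0| + r * `|point2 0 1|) => z zr.
  rewrite (_ : P z = F0 z *: point2 1 0 + F1 z *: point2 0 1); last first.
    by rewrite !scale_point2 add_point2 !mulr1 !mulr0 addr0 add0r.
  rewrite (le_trans (ler_normD _ _))// lerD// normrZ ler_wpM2r//.
    exact: le_trans (F01 _ F0le _) zr.
  exact: le_trans (F01 _ F1le _) zr.
- by move=> v; rewrite /= /Q F0i F1i point2_coord.
- move=> _ [z z1 <-]; rewrite /square/= /Q coord2_point0 coord2_point1.
  by split; [exact: le_trans (F01 _ F0le _) z1|exact: le_trans (F01 _ F1le _) z1].
Qed.

(** * Minimality and shape of the square *)

Lemma projection_forced (P : {linear Y -> X}) : cancel embed P ->
  P @` unit_ball Y `<=` square -> P (point3 0 0 1) = 0.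
Proof.
move=> Pe Psq.
have Ple j w : coord2 j (P w) <= `|w|.
  apply: (@norm_unit_ball_le R Y (coord2 j \o P)) => v v1 /=.
  have [P0 P1] : square (P v) by apply: Psq; exists v.
  case: j => -[|[|//]] lti; apply: le_trans (ler_norm _) _.
  - by rewrite (_ : Ordinal lti = 0)//; apply: val_inj.
  - by rewrite (_ : Ordinal lti = 1)//; apply: val_inj.
have PleN j w : - coord2 j (P w) <= `|w| by rewrite -normrN -!linearN Ple.
set a := coord2 0 (P (point3 0 0 1)); set b := coord2 1 (P (point3 0 0 1)).
have P0 x y z : coord2 0 (P (point3 x y z)) = x + z * a.
  by rewrite point3E !linearD !linearZ/= Pe coord2_point0.
have P1 x y z : coord2 1 (P (point3 x y z)) = y + z * b.
  by rewrite point3E !linearD !linearZ/= Pe coord2_point1.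
have [Q1 Q2] := cut_disc_norm_corners R.
(* These four bounds give [b = 0] and [-2 <= a <= 0]. *)
have := Ple 0 (point3 1 1 1); have := Ple 1 (point3 1 1 1).
have := PleN 1 (point3 1 (-1) 1); have := PleN 0 (point3 1 1 1).
rewrite !P0 !P1 !norm_point3 => H1 H2 H3 H4.
(* With [t = - a / 4] the first coordinate of the image is [1 + a^2 / 4], while the norm is at most
   [1 + a^2 / 8]; so [a = 0]. *)
have t01 : 0 <= - a / 4 <= 1 by apply/andP; split; lra.
have := Ple 0 (point3 1 (- (- a / 4)) (- (- a / 4))).
rewrite P0 norm_point3 => /le_trans /(_ (cut_disc_norm_curve t01)) H5.
have a0 : a = 0 by nra.
have b0 : b = 0 by lra.
rewrite -[LHS]point2_coord -/a -/b a0 b0.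
by apply/rowP => -[[|[|//]] lti]; rewrite !mxE.
Qed.

Lemma square_minimal (A : set X) :
  sufficient_enlargement A -> A `<=` square -> square `<=` A.
Proof.
move=> [[_ _ cA _ symA] /(_ Y embed embed_isometry)[P [_ Pe PA]]] Asq.
have Pz0 := projection_forced Pe (subset_trans PA Asq).
have PE x y z : P (point3 x y z) = point2 x y.
  by rewrite point3E linearD linearZ/= Pe Pz0 scaler0 addr0.
have [Q1 Q2] := cut_disc_norm_corners R.
have A11 : A (point2 1 1).
  by apply: PA; exists (point3 1 1 1); rewrite /unit_ball/= ?norm_point3.
have A1N1 : A (point2 1 (-1)).
  by apply: PA; exists (point3 1 (-1) 1); rewrite /unit_ball/= ?norm_point3.
have AN x y : A (point2 x y) -> A (point2 (- x) (- y)).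
  by move/symA; rewrite -scaleN1r scale_point2 !mulN1r.
(* Convexity fills the side joining the two corners; symmetry then gives the opposite side. *)
have A1 y : `|y| <= 1 -> A (point2 1 y).
  rewrite ler_norml => /andP[y0 y1].
  have t01 : 0 <= (1 + y) / 2 <= 1 by apply/andP; split; lra.
  have := convex_set_line cA A11 A1N1 t01.
  rewrite !scale_point2 add_point2; congr (A (point2 _ _)); lra.
move=> v [v0 v1]; rewrite -(point2_coord v).
move: (coord2 0 v) (coord2 1 v) v0 v1 => x y.
rewrite ler_norml => /andP[x0 x1] y1.
have t01 : 0 <= (1 + x) / 2 <= 1 by apply/andP; split; lra.
have Ny1 : `|- y| <= 1 by rewrite normrN.
(* The horizontal segment from [(-1, y)] to [(1, y)] passes through the point. *)
have := convex_set_line cA (A1 _ y1) (AN _ _ (A1 _ Ny1)) t01.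
rewrite opprK !scale_point2 add_point2; congr (A (point2 _ _)); lra.
Qed.

Lemma parallelogram_square : parallelogram square.
Proof.
exists (point2 (-1) (-1)), (point2 2 0), (point2 0 2); split.
  move=> a b /(congr1 (fun v => (coord2 0 v, coord2 1 v))).
  rewrite !scale_point2 add_point2 !coord2_point0 !coord2_point1.
  by rewrite /coord2 !mxE => -[]; lra.
apply/seteqP; split=> [v [v0 v1]|_ [s + [t + <-]]].
  move: v0 v1; rewrite !ler_norml => v0 v1.
  exists ((1 + coord2 0 v) / 2); first by rewrite /= in_itv/=; lra.
  exists ((1 + coord2 1 v) / 2); first by rewrite /= in_itv/=; lra.
  rewrite !scale_point2 !add_point2 -[RHS]point2_coord.
  congr point2; lra.
rewrite /= !in_itv/= => s01 t01.
rewrite /square/= !scale_point2 !add_point2 coord2_point0 coord2_point1.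
by rewrite !ler_norml; lra.
Qed.

End Example.

Theorem theorem2 (R : realType) :
  exists (X : normedModType R) (f1 f2 : {linear X -> R^o}),
    [/\ has_dim 2 X, dual_unit_ball X f1, dual_unit_ball X f2
      & exists x1 x2 : X,
        [/\ unique (fun x => unit_ball X x /\ f1 x = 1) x1
              /\ unique (fun x => unit_ball X x /\ f2 x = 1) x2,
            let C := [set x : X | `|f1 x| <= 1 /\ `|f2 x| <= 1] in
              parallelogram C /\ minimal_sufficient_enlargement C
          & exists f3 : {linear X -> R^o},
              [/\ dual_unit_ball X f3, `|f3 x1| = 1 & `|f3 x2| = 1]]].
Proof.
exists (plane R), (@coord2 R 0), (@coord2 R 1); split.
- pose h (v : plane R) : 'rV[R]_2 := v.
  have hlin : linear h by [].
  pose M := GRing.isLinear.Build R (plane R) 'rV[R]_2 *:%R h hlin.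
  pose H : {linear plane R -> 'rV[R]_2} := HB.pack h M.
  by exists H; exists h.
- exact/dual_unit_ballP/coord2_le_norm.
- exact/dual_unit_ballP/coord2_le_norm.
exists (point2 1 0), (point2 0 1); split.
- split; split=> [|v []].
  + rewrite /= coord2_point0 /unit_ball/= norm_point2; split=> //.
    exact/cut_disc_norm_1l_le1.
  + rewrite -{1 3}(point2_coord v) /unit_ball/= norm_point2 => + v0.
    by rewrite v0 => /cut_disc_norm_1l_le1 ->.
  + rewrite /= coord2_point1 /unit_ball/= norm_point2; split=> //.
    exact/cut_disc_norm_1r_le1.
  + rewrite -{1 3}(point2_coord v) /unit_ball/= norm_point2 => + v1.
    by rewrite v1 => /cut_disc_norm_1r_le1 ->.
- split; first exact: parallelogram_square.
  split; first exact: sufficient_square.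
  move=> A [Asq nsqA] sA; apply: nsqA; exact: square_minimal.
- exists (@coord2 R 0 \+ @coord2 R 1); split.
  + apply: dual_unit_ballP => v /=.
    rewrite -{3}(point2_coord v) norm_point2.
    have [_ _ _] := cut_disc_norm_coord (coord2 0 v) (coord2 1 v) 0.
    by rewrite subr0; apply: le_trans (ler_norm _).
  + by rewrite /= coord2_point0 coord2_point1 addr0 normr1.
  + by rewrite /= coord2_point0 coord2_point1 add0r normr1.
Qed.
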